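(* For every $n\in\mathbb{N}$, the polynomial $(-q;q)_n=\prod_{0<k\le n}(1+q^k)$ divides $S_{2n}(q)$ in the ring $\mathbb{Z}[q]$.
   Context: For $n\in\mathbb{N}$, $(a;q)_n=\prod_{0\le k<n}(1-aq^k)$ (with $(a;q)_0=1$). The $q$-Sali\'e numbers $S_n(q)$ ($n\in\mathbb{N}$) are defined by the formal power series identity $$\sum_{n=0}^\infty S_{n}(q)\frac{x^{n}}{(q;q)_{n}}=\sum_{n=0}^\infty \frac{q^{n(n-1)}x^{2n}}{(q;q)_{2n}}\Big/\sum_{n=0}^\infty \frac{(-1)^nq^{\binom{2n}{2}}x^{2n}}{(q;q)_{2n}};$$ they are polynomials in $q$ with integer coefficients. *)

(* Defs.v *)
From HB Require Import structures.
From mathcomp Require Import all_boot all_order all_algebra.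
From mathcomp Require Import ring.

Set Implicit Arguments.
Unset Strict Implicit.
Unset Printing Implicit Defensive.

Import GRing.Theory.
Local Open Scope ring_scope.

Definition qpoch (R : pzRingType) (a q : R) (n : nat) : R :=
  \prod_(k < n) (1 - a * q ^+ k).

(* A formal power series over K is its sequence of coefficients nat -> K. *)
Section FormalPowerSeries.
Variable K : fieldType.
Implicit Types f g : nat -> K.

Definition fps_mul f g : nat -> K :=
  fun n => \sum_(i < n.+1) f i * g (n - i)%N.

(* The list of the first n coefficients of 1 / g, for g with g 0 != 0. *)
Fixpoint fps_inv_seq g n : seq K :=
  if n is m.+1 then
    let s := fps_inv_seq g m in
    rcons s (((m == 0%N)%:R - \sum_(i < m) s`_i * g (m - i)%N) / g 0%N)
  else [::].

Definition fps_inv g : nat -> K := fun n => (fps_inv_seq g n.+1)`_n.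

Definition fps_div f g : nat -> K := fps_mul f (fps_inv g).

(* \sum_n c_n x^(2n) *)
Definition fps_even (c : nat -> K) : nat -> K :=
  fun m => if odd m then 0 else c m./2.

Lemma size_fps_inv_seq g n : size (fps_inv_seq g n) = n.
Proof. by elim: n => //= n IHn; rewrite size_rcons IHn. Qed.

Lemma nth_fps_inv_seq g n i :
  (i < n)%N -> (fps_inv_seq g n)`_i = fps_inv g i.
Proof.
elim: n => // n IHn; rewrite ltnS leq_eqVlt => /predU1P[-> //|lt_in].
by rewrite /= nth_rcons size_fps_inv_seq lt_in IHn.
Qed.

Lemma fps_invE g n :
  fps_inv g n =
    ((n == 0%N)%:R - \sum_(i < n) fps_inv g i * g (n - i)%N) / g 0%N.
Proof.
rewrite {1}/fps_inv /= nth_rcons size_fps_inv_seq ltnn eqxx.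
by congr ((_ - _) / _); apply: eq_bigr => i _; rewrite nth_fps_inv_seq.
Qed.

Lemma fps_mulVf g :
  g 0%N != 0 -> forall n, fps_mul (fps_inv g) g n = (n == 0%N)%:R.
Proof.
move=> g0 n; rewrite /fps_mul big_ord_recr /= subnn [X in X * g 0%N]fps_invE.
by rewrite divfK // addrC subrK.
Qed.

Lemma fps_mulE f g N n : (n < N)%N ->
  fps_mul f g n = (\poly_(i < N) f i * \poly_(i < N) g i)`_n.
Proof.
move=> ltnN; rewrite coefM; apply: eq_bigr => i _; rewrite !coef_poly.
rewrite (leq_ltn_trans _ ltnN) ?leq_ord //.
by rewrite (leq_ltn_trans (leq_subr _ _) ltnN).
Qed.

Lemma fps_mulA f g h n :
  fps_mul (fps_mul f g) h n = fps_mul f (fps_mul g h) n.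
Proof.
transitivity
    ((\poly_(i < n.+1) f i * \poly_(i < n.+1) g i * \poly_(i < n.+1) h i)`_n).
  rewrite coefM; apply: eq_bigr => i _; rewrite (@fps_mulE _ _ n.+1) //.
  by rewrite !coef_poly ltnS leq_subr.
rewrite -mulrA coefM; apply: eq_bigr => i _.
by rewrite -fps_mulE ?ltnS ?leq_subr // coef_poly ltn_ord.
Qed.

Lemma fps_divK f g :
  g 0%N != 0 -> forall n, fps_mul (fps_div f g) g n = f n.
Proof.
move=> g0 n; rewrite fps_mulA [LHS]/fps_mul big_ord_recr subnn.
rewrite fps_mulVf // mulr1 big1 /= ?add0r // => i _.
by rewrite fps_mulVf // subn_eq0 leqNgt ltn_ord mulr0.
Qed.

End FormalPowerSeries.

(* The field Q(q), as the fraction field of Z[q]. *)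
Local Notation Kq := {fraction {poly int}}.
Local Notation "p %:F" := (@tofrac {poly int} p).
Local Notation q := ('X%:F : Kq).

Definition qSalie_num : nat -> Kq :=
  fps_even (fun n => q ^+ (n * (n - 1)) / qpoch q q n.*2).

Definition qSalie_den : nat -> Kq :=
  fps_even (fun n => (-1) ^+ n * q ^+ 'C(n.*2, 2) / qpoch q q n.*2).

(* S_n(q) as an element of Q(q): (q;q)_n times the coefficient of x^n. *)
Definition qSalie_frac (n : nat) : Kq :=
  qpoch q q n * fps_div qSalie_num qSalie_den n.

Fixpoint qbin (n k : nat) : {poly int} :=
  match n, k with
  | _, 0 => 1
  | 0, _.+1 => 0
  | n.+1, k.+1 => qbin n k + 'X^(k.+1) * qbin n k.+1
  end.

Lemma qpochS (R : pzRingType) (a x : R) n :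
  qpoch a x n.+1 = qpoch a x n * (1 - a * x ^+ n).
Proof. by rewrite /qpoch big_ord_recr. Qed.

Lemma qbin_small n k : (n < k)%N -> qbin n k = 0.
Proof.
by elim: n k => [|n IHn] [|k] //= lt_nk; rewrite !IHn ?mulr0 ?addr0 // ltnW.
Qed.

Lemma qbin_fact m k :
  qbin (k + m) k * qpoch 'X 'X k * qpoch 'X 'X m = qpoch 'X 'X (k + m).
Proof.
move Dn: (k + m)%N => n; elim: n k m Dn => [|n IHn] [|k] m //=.
- by rewrite add0n => ->; rewrite /qpoch !big_ord0 !mulr1.
- by rewrite add0n => ->; rewrite /qpoch big_ord0 !mul1r.
rewrite addSn => -[Dn]; rewrite mulrDl mulrDl.
have -> : qbin n k * qpoch 'X 'X k.+1 * qpoch 'X 'X m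
          = qpoch 'X 'X n * (1 - 'X^(k.+1)).
  by rewrite qpochS -exprS mulrA mulrAC IHn.
case: m Dn => [|m] Dn.
  rewrite qbin_small -Dn ?addn0 // mulr0 !mul0r addr0.
  by rewrite qpochS exprS.
have -> : 'X^(k.+1) * qbin n k.+1 * qpoch 'X 'X k.+1 * qpoch 'X 'X m.+1
          = 'X^(k.+1) * (qpoch 'X 'X n * (1 - 'X^(m.+1))).
  rewrite [qpoch _ _ m.+1]qpochS -exprS -(IHn k.+1 m) ?mulrA //.
  by rewrite addSnnS.
rewrite qpochS -exprS -Dn -addSn exprD.
by rewrite [RHS]mulrBr mulr1 !mulrBr !mulr1 (mulrCA 'X^(k.+1))
           (mulrC 'X^(k.+1) (qpoch _ _ _)) addrA subrK mulrA.
Qed.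

Lemma tofrac_qpoch n : qpoch q q n = (qpoch 'X 'X n)%:F.
Proof.
by rewrite rmorph_prod; apply: eq_bigr => i _; rewrite rmorphB rmorph1 rmorphM rmorphXn.
Qed.

Lemma qpoch_neq0 n : qpoch q q n != 0.
Proof.
apply/prodf_neq0 => i _; rewrite -exprS -rmorphXn -(rmorph1 (@tofrac _)).
rewrite -rmorphB tofrac_eq0 subr_eq0; apply/eqP=> /(congr1 (fun p => size (p : {poly int}))).
by rewrite size_polyXn size_poly1.
Qed.

Lemma qSalie_frac_poly n : exists s : {poly int}, s%:F == qSalie_frac n.
Proof.
pose F := fps_div qSalie_num qSalie_den.
pose a m : {poly int} := if odd m then 0 else 'X^(m./2 * (m./2 - 1)).
pose b m : {poly int} := if odd m then 0 else (-1) ^+ m./2 * 'X^('C(m, 2)).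
have aE m : qSalie_num m * qpoch q q m = (a m)%:F.
  rewrite /qSalie_num /fps_even /a; case: ifPn => [_|ev]; first by rewrite mul0r rmorph0.
  by rewrite even_halfK // divfK ?qpoch_neq0 // rmorphXn.
have bE m : qSalie_den m * qpoch q q m = (b m)%:F.
  rewrite /qSalie_den /fps_even /b; case: ifPn => [_|ev]; first by rewrite mul0r rmorph0.
  rewrite even_halfK // divfK ?qpoch_neq0 //.
  by rewrite rmorphM !rmorphXn rmorphN1.
have den0 : qSalie_den 0%N = 1.
  by rewrite /qSalie_den /fps_even /= !expr0 /qpoch big_ord0 divr1 mulr1.
have FE m : F m = qSalie_num m - \sum_(i < m) F i * qSalie_den (m - i)%N.
  rewrite -(@fps_divK _ qSalie_num qSalie_den) ?den0 ?oner_eq0 //.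
  by rewrite /fps_mul big_ord_recr /= subnn den0 mulr1 addrC addrK.
elim/ltn_ind: n => n IHn.
have [t tE] : exists t : {poly int},
    t%:F = \sum_(i < n) qpoch q q n * (F i * qSalie_den (n - i)%N).
  apply: (big_ind (fun x : Kq => exists t : {poly int}, t%:F = x)).
  - by exists 0; rewrite rmorph0.
  - by move=> _ _ [u <-] [v <-]; exists (u + v); rewrite rmorphD.
  move=> i _; have [s /eqP sE] := IHn i (ltn_ord i).
  exists (s * qbin n i * b (n - i)%N); rewrite !rmorphM /= sE -bE.
  have := congr1 (@tofrac _) (qbin_fact (n - i) i).
  rewrite subnKC ?(ltnW (ltn_ord i)) // !rmorphM /= -!tofrac_qpoch => <-.
  by rewrite /qSalie_frac -/F; ring.
exists (a n - t); rewrite rmorphB /= tE -aE /qSalie_frac -/F FE -mulr_sumr.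
by rewrite mulrBr mulrC.
Qed.

(* The choice is unique, since tofrac is injective. *)
Definition qSalie (n : nat) : {poly int} := xchoose (qSalie_frac_poly n).

Lemma qSalieE n : (qSalie n)%:F = qSalie_frac n.
Proof. exact/eqP/(xchooseP (qSalie_frac_poly n)). Qed.

(* Main.v *)
(* Over Q = q^2, the q-Vandermonde sum gives
     [2k+2m, 2k]_q
       = sum_j [k+m, 2j]_Q (-q;q)_{2j} q^{j(2j-1)} [k+m-2j, k-j]_Q,
   and [a+b, a]_Q (-q;q)_a (-q;q)_b = [a+b, a]_q (-q;q)_{a+b}.  Hence (-q;q)_n
   divides [2n, 2k]_q (-q;q)_k (-q;q)_{n-k}: the even series
   sum_n a_n x^{2n} / (q;q)_{2n} with (-q;q)_n | a_n are closed under products,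
   and under quotients by those with a_0 = 1.  It remains to multiply numerator
   and denominator of the q-Salie series by sum_n (-1)^n x^{2n} / (q;q)_{2n}:
   the denominator becomes
     1 + sum_{n>0} (-1)^n (-q;q)_{2n-1} x^{2n} / (q;q)_{2n},
   while the coefficients sum_k (-1)^{n-k} [2n, 2k]_q q^{k(k-1)} of the
   numerator are divisible by (-q;q)_n, because after the expansion above the
   sum over k is a q-binomial sum equal, up to a sign and a power of q, to
   (q^{2j}; q^2)_{n-2j}. *)
Require Import Defs.
From mathcomp Require Import all_boot all_order all_algebra.
From mathcomp Require Import ring zify.
Import GRing.Theory.
Local Open Scope ring_scope.

Set Implicit Arguments.
Unset Strict Implicit.
Unset Printing Implicit Defensive.

(** * q-Pochhammer symbols *)

Section QPochhammer.
Variable R : comPzRingType.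
Implicit Types a x : R.

Lemma qpoch0 a x : qpoch a x 0 = 1.
Proof. by rewrite /qpoch big_ord0. Qed.

Lemma qpochD a x m n :
  qpoch a x (m + n) = qpoch a x m * qpoch (a * x ^+ m) x n.
Proof.
rewrite /qpoch big_split_ord /=; congr (_ * _).
by apply: eq_bigr => i _; rewrite exprD mulrA.
Qed.

Lemma qpochSl a x n : qpoch a x n.+1 = (1 - a) * qpoch (a * x) x n.
Proof. by rewrite -add1n qpochD qpochS qpoch0 mul1r expr0 expr1 mulr1. Qed.

Lemma qpoch1 x n : qpoch 1 x n.+1 = 0.
Proof. by rewrite qpochSl subrr mul0r. Qed.

Lemma qpoch_double a x n :
  qpoch a x n.*2 = qpoch a (x ^+ 2) n * qpoch (a * x) (x ^+ 2) n.
Proof.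
elim: n => [|n IHn]; first by rewrite !qpoch0 mulr1.
rewrite doubleS !qpochS IHn -!exprM mul2n [x ^+ n.*2.+1]exprS; ring.
Qed.

Lemma qpoch_sqr a x n :
  qpoch (a ^+ 2) (x ^+ 2) n = qpoch a x n * qpoch (- a) x n.
Proof.
rewrite /qpoch -big_split; apply: eq_bigr => i _ /=.
by rewrite -exprM mulnC exprM; ring.
Qed.

End QPochhammer.

(** * Gaussian binomials in base [x], and their summation theorems *)

Definition gbin (x : {poly int}) n k := qbin n k \Po x.

Section GaussBinomial.
Variable x : {poly int}.

Lemma gbin0 n : gbin x n 0 = 1.
Proof. by rewrite /gbin; case: n => [|n]; rewrite /= rmorph1. Qed.

Lemma gbinS n k :
  gbin x n.+1 k.+1 = gbin x n k + x ^+ k.+1 * gbin x n k.+1.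
Proof. by rewrite /gbin /= rmorphD rmorphM rmorphXn /= comp_polyX. Qed.

Lemma gbin_small n k : (n < k)%N -> gbin x n k = 0.
Proof. by move=> lt_nk; rewrite /gbin qbin_small // rmorph0. Qed.

Lemma gbin_fact m k :
  gbin x (k + m) k * qpoch x x k * qpoch x x m = qpoch x x (k + m).
Proof.
have E n : qpoch 'X 'X n \Po x = qpoch x x n.
  rewrite rmorph_prod; apply: eq_bigr => i _.
  by rewrite rmorphB rmorph1 rmorphM rmorphXn /= comp_polyX.
by rewrite -!E /gbin -!rmorphM qbin_fact.
Qed.

(** Pascal's rule summed over [j]: it gives the induction step of both summation theorems below. *)
Lemma gbin_sumS (F : nat -> {poly int}) n :
  \sum_(j < n.+2) gbin x n.+1 j * F j =
  \sum_(j < n.+1) gbin x n j * (x ^+ j * F j + F j.+1).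
Proof.
rewrite [RHS](eq_bigr _ (fun _ _ => mulrDr _ _ _)) big_split /=.
rewrite big_ord_recl [X in _ = X + _]big_ord_recl !gbin0 expr0 !mul1r -addrA.
congr (_ + _); pose G i := gbin x n i.+1 * (x ^+ i.+1 * F i.+1).
transitivity (\sum_(i < n.+1) (G i + gbin x n i * F i.+1)).
  by apply: eq_bigr => i _; rewrite lift0 gbinS /G; ring.
rewrite big_split big_ord_recr {2}/G /= gbin_small // mul0r addr0.
by congr (_ + _); apply: eq_bigr => i _; rewrite lift0.
Qed.

Lemma qbinomial_theorem z n :
  \sum_(j < n.+1) gbin x n j * (x ^+ 'C(j, 2) * z ^+ j) = qpoch (- z) x n.
Proof.
elim: n z => [|n IHn] z.
  by rewrite big_ord1 gbin0 qpoch0 !mulr1.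
rewrite (gbin_sumS (fun j => x ^+ 'C(j, 2) * z ^+ j)) qpochSl opprK mulNr -IHn.
rewrite mulr_sumr; apply: eq_bigr => j _.
by rewrite binS bin1 exprD exprMn exprS; ring.
Qed.

(** Induction on [k] for all [c]: after [gbin_sumS], each term is [1 - c * y] times the
    corresponding term for [c * x]. *)
Lemma qVandermonde (c y : {poly int}) k :
  \sum_(j < k.+1) gbin x k j *
    (c ^+ j * x ^+ 'C(j, 2) * \prod_(i < j) (x ^+ i - y)
       * qpoch (c * x ^+ j) x (k - j)) = qpoch (c * y) x k.
Proof.
elim: k c => [|k IHk] c.
  by rewrite big_ord1 gbin0 qpoch0 big_ord0 qpoch0 !mulr1.
rewrite (gbin_sumS (fun j => c ^+ j * x ^+ 'C(j, 2)
  * \prod_(i < j) (x ^+ i - y) * qpoch (c * x ^+ j) x (k.+1 - j))).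
rewrite qpochSl [c * y * x]mulrAC -IHk mulr_sumr.
apply: eq_bigr => j _; rewrite subSS subSn ?leq_ord // qpochSl.
rewrite big_ord_recr binS bin1 /= !exprS exprD exprMn.
rewrite [c * x ^+ j * x]mulrAC [c * (x * _)]mulrA.
by set P := qpoch _ _ _; ring.
Qed.

End GaussBinomial.

(** Evaluates the product in [qVandermonde] at [y = x ^+ m], where each factor is x^i (1 -
    x^(m-i)). *)
Lemma qpoch_pow_falling (x : {poly int}) m j : (j <= m)%N ->
  qpoch x x (m - j) * \prod_(i < j) (x ^+ i - x ^+ m) =
  qpoch x x m * x ^+ 'C(j, 2).
Proof.
elim: j => [|j IHj] le_jm; first by rewrite subn0 big_ord0.
rewrite big_ord_recr binS bin1 exprD /= [in RHS]mulrA -IHj 1?ltnW //.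
have -> : x ^+ m = x ^+ j * x ^+ (m - j.+1).+1.
  by rewrite -exprD subnSK // subnKC // ltnW.
by rewrite -[(m - j)%N in RHS]subnSK // qpochS -exprS; ring.
Qed.

(** * Expansion of [2k+2m, 2k]_q in base q^2 *)

Lemma qbinE n k : qbin n k = gbin 'X n k.
Proof. by rewrite /gbin comp_polyXr. Qed.

Definition qX2 : {poly int} := 'X ^+ 2.

Lemma qpochXX n :
  qpoch 'X 'X n.*2 = qpoch 'X qX2 n * qpoch qX2 qX2 n.
Proof. by rewrite qpoch_double -expr2. Qed.

Lemma qpochX2X2 n : qpoch qX2 qX2 n = qpoch 'X 'X n * qpoch (- 'X) 'X n.
Proof. exact: qpoch_sqr. Qed.

Lemma qpoch_pow_neq0 (i j n : nat) :
  (0 < i)%N -> (0 < j)%N -> qpoch ('X^i) ('X^j) n != 0 :> {poly int}.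
Proof.
move=> i0 j0; apply/prodf_neq0 => k _; rewrite -exprM -exprD.
apply/eqP => /eqP; rewrite subr_eq0.
move=> /eqP/(congr1 (fun p : {poly int} => size p)).
by rewrite size_polyXn size_poly1; case: i i0.
Qed.

Lemma bin_double2 j : 'C(j.*2, 2) = (j + 2 * ('C(j, 2) + 'C(j, 2)))%N.
Proof. by elim: j => // j IHj; rewrite doubleS !binS !bin1 bin0; lia. Qed.

Lemma mul_pred_bin2 n : (n * (n - 1) = 2 * 'C(n, 2))%N.
Proof. by elim: n => // n; rewrite binS bin1; nia. Qed.

(** Termwise form of [qbin_double]; here [k] and [m] stand for its [k - j] and [m - j], which avoids
    truncated subtraction. *)
Lemma qbin_double_term j k m (Q := qX2) (n := (j + k + (j + m))%N) :
  gbin Q n j.*2 * qpoch (- 'X) 'X j.*2 * 'X^('C(j.*2, 2))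
    * gbin Q (n - j.*2) k
    * (qpoch 'X 'X (j + k).*2 * qpoch 'X 'X (j + m).*2) =
  qpoch Q Q n * qpoch 'X Q (j + m) *
  (gbin Q (j + k) j *
    ('X^j * Q ^+ 'C(j, 2) * \prod_(i < j) (Q ^+ i - Q ^+ (j + m))
     * qpoch ('X * Q ^+ j) Q k)).
Proof.
have nE : n = (j.*2 + (k + m))%N by rewrite /n -addnn addnACA.
have -> : 'X^('C(j.*2, 2)) = 'X^j * Q ^+ 'C(j, 2) * Q ^+ 'C(j, 2).
  rewrite -!exprM -!exprD; congr ('X^ _).
  by rewrite bin_double2 -addnA -mulnDr.
have Pj := qpoch_pow_falling Q (leq_addr m j).
rewrite addKn in Pj.
rewrite nE addKn -[qpoch Q Q (j.*2 + _)]gbin_fact -[qpoch Q Q (k + m)]gbin_fact.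
rewrite qpochX2X2 !qpochXX -/Q (qpochD _ _ j k) -(gbin_fact Q k j).
ring: Pj.
Qed.

(* The q^2-Vandermonde sum with c = q and y = q^(2m), after multiplication by
   (q;q)_{2k} (q;q)_{2m}. *)
Lemma qbin_double k m (Q := qX2) :
  qbin (k + m).*2 k.*2 =
  \sum_(j < k.+1 | (j <= m)%N)
    gbin Q (k + m) j.*2 * qpoch (- 'X) 'X j.*2 * 'X^('C(j.*2, 2))
    * gbin Q (k + m - j.*2) (k - j).
Proof.
apply: (@mulIf _ (qpoch 'X 'X k.*2 * qpoch 'X 'X m.*2)).
  by rewrite mulf_neq0 // (qpoch_pow_neq0 (i := 1) (j := 1)).
transitivity (qpoch Q Q (k + m) * qpoch 'X Q m * qpoch ('X * Q ^+ m) Q k).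
  rewrite mulrA doubleD qbinE gbin_fact -doubleD qpochXX.
  by rewrite [in qpoch 'X _ _]addnC qpochD; ring.
rewrite -qVandermonde mulr_sumr mulr_suml [RHS]big_mkcond.
apply: eq_bigr => j _; have le_jk : (j <= k)%N by rewrite -ltnS.
case: leqP => [le_jm | lt_mj].
  by have := qbin_double_term j (k - j) (m - j); rewrite !subnKC // => ->.
(* For [j > m] the Vandermonde term vanishes through its factor of index [m]. *)
rewrite (bigD1 (Ordinal lt_mj)) //= subrr; ring.
Qed.

(** * Divisibility by (-q;q)_n in Z[q] *)

Definition pdvd (d p : {poly int}) := exists r, p = d * r.

Lemma pdvd_mull d p r : pdvd d p -> pdvd d (r * p).
Proof. by move=> [s ->]; exists (r * s); ring. Qed.

Lemma pdvd_add d p r : pdvd d p -> pdvd d r -> pdvd d (p + r).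
Proof. by move=> [s ->] [t ->]; exists (s + t); rewrite mulrDr. Qed.

Lemma pdvd_sum d (I : finType) (P : pred I) (F : I -> {poly int}) :
  (forall i, P i -> pdvd d (F i)) -> pdvd d (\sum_(i | P i) F i).
Proof.
move=> dF; apply: big_ind => //; first by exists 0; rewrite mulr0.
exact: pdvd_add.
Qed.

Local Notation qneg n := (qpoch (- 'X) 'X n : {poly int}).

Lemma gbin_qneg k m :
  gbin qX2 (k + m) k * qneg k * qneg m = qbin (k + m) k * qneg (k + m).
Proof.
apply: (@mulIf _ (qpoch 'X 'X k * qpoch 'X 'X m)).
  by rewrite mulf_neq0 // (qpoch_pow_neq0 (i := 1) (j := 1)).
transitivity (qpoch 'X 'X (k + m) * qneg (k + m)).
  by rewrite -qpochX2X2 -gbin_fact !qpochX2X2; ring.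
by rewrite -qbin_fact; ring.
Qed.

Lemma pdvd_qneg_le m n : (m <= n)%N -> pdvd (qneg m) (qneg n).
Proof. by move/subnKC <-; rewrite qpochD; eexists. Qed.

Lemma pdvd_qneg_conv k m :
  pdvd (qneg (k + m)) (qbin (k + m).*2 k.*2 * qneg k * qneg m).
Proof.
rewrite qbin_double -mulrA mulr_suml; apply: pdvd_sum => j le_jm.
have le_jk : (j <= k)%N by rewrite -ltnS.
have nE : (k + m = j.*2 + ((k - j) + (m - j)))%N by lia.
rewrite nE addKn.
(* By [gbin_qneg], (-q;q)_{k-j} and (-q;q)_{m-j} merge into (-q;q)_{k+m-2j}, which merges with
   (-q;q)_{2j} into (-q;q)_{k+m}. *)
have [u ->] := pdvd_qneg_le (leq_subr j k).
have [v ->] := pdvd_qneg_le (leq_subr j m).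
exists (qbin (j.*2 + (k - j + (m - j))) j.*2 * qbin (k - j + (m - j)) (k - j)
        * 'X^('C(j.*2, 2)) * u * v).
have A := gbin_qneg j.*2 (k - j + (m - j)).
have B := gbin_qneg (k - j) (m - j).
ring: A B.
Qed.

(** With Q = q^2, (Q^j;Q)_l = [j-1+l, l]_Q (Q;Q)_l, and (Q;Q)_l = (q;q)_l (-q;q)_l. *)
Lemma pdvd_qneg_qpoch j l : (0 < j)%N ->
  pdvd (qneg l) (qpoch (qX2 ^+ j) qX2 l).
Proof.
case: j => // j _; exists (gbin qX2 (j + l) j * qpoch 'X 'X l).
apply: (@mulIf _ (qpoch qX2 qX2 j)).
  exact: (qpoch_pow_neq0 (i := 2) (j := 2)).
have := gbin_fact qX2 l j.
rewrite [in RHS]qpochD -exprS qpochX2X2 => E.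
by rewrite [LHS]mulrC -E qpochX2X2; ring.
Qed.

Lemma sum_ord_middle (F : nat -> {poly int}) j l :
  (forall i, (i < j)%N -> F i = 0) ->
  (forall i, (j + l < i <= j.*2 + l)%N -> F i = 0) ->
  \sum_(k < (j.*2 + l).+1) F k = \sum_(i < l.+1) F (j + i)%N.
Proof.
move=> F0 F1; rewrite -(big_mkord xpredT F).
have -> : (j.*2 + l).+1 = (j + (l.+1 + j))%N by lia.
rewrite big_mkord !big_split_ord /= big1 ?add0r => [|i _]; last exact: F0.
by rewrite [X in _ + X]big1 ?addr0 // => i _; apply: F1; have := ltn_ord i; lia.
Qed.

(** The product of the series sum_n u_n x^(2n) / (q;q)_{2n}, read on the coefficients u_n. *)
Definition qconv (u v : nat -> {poly int}) n : {poly int} :=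
  \sum_(k < n.+1) qbin n.*2 k.*2 * u k * v (n - k)%N.

Lemma pdvd_qneg_numerator n :
  pdvd (qneg n) (qconv (fun k => 'X^(k * (k - 1))) (fun k => (-1) ^+ k) n).
Proof.
have [-> | n_gt0] := posnP n; first by rewrite qpoch0; eexists; rewrite mul1r.
pose A j := gbin qX2 n j.*2 * qneg j.*2 * 'X^('C(j.*2, 2)).
pose F j k := if (j <= k)%N && (j <= n - k)%N
  then A j * (gbin qX2 (n - j.*2) (k - j) * 'X^(k * (k - 1)) * (-1) ^+ (n - k))
  else 0.
have -> : qconv (fun k => 'X^(k * (k - 1))) (fun k => (-1) ^+ k) n
   = \sum_(j < n.+1) \sum_(k < n.+1) F j k.
  rewrite exchange_big; apply: eq_bigr => k _.
  have le_kn : (k <= n)%N by rewrite -ltnS.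
  have := qbin_double k (n - k); rewrite subnKC // => ->.
  rewrite (big_ord_widen_cond n.+1 (fun j => (j <= n - k)%N)
    (fun j => A j * gbin qX2 (n - j.*2) (k - j))) // !mulr_suml big_mkcond.
  apply: eq_bigr => j _; rewrite /F ltnS andbC; case: ifP => // _; ring.
apply: pdvd_sum => -[j /= _] _.
have [le_jn | lt_nj] := leqP j.*2 n; last first.
  rewrite big1; first by exists 0; rewrite mulr0.
  by move=> k _; rewrite /F ifF //; lia.
pose l := (n - j.*2)%N.
have nE : n = (j.*2 + l)%N by rewrite subnKC.
(* Only j <= k <= j + l contributes; with k = j + i this is the q-binomial theorem in base q^2 at z
   = -q^(2j). *)
have -> : \sum_(k < n.+1) F j k =
    A j * (-1) ^+ (j + l) * 'X^(j * (j - 1)) * qpoch (qX2 ^+ j) qX2 l.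
  rewrite nE sum_ord_middle; last 2 first.
  - by move=> i lt_ij; rewrite /F ifF //; lia.
  - by move=> i /andP[lt_ji le_in]; rewrite /F ifF //; lia.
  rewrite -(opprK (qX2 ^+ j)) -qbinomial_theorem mulr_sumr.
  apply: eq_bigr => i _; have le_il : (i <= l)%N by rewrite -ltnS.
  rewrite /F ifT; last by lia.
  have -> : (n - (j + i) = j + l - i)%N by lia.
  rewrite addKn -/l [(- qX2 ^+ j) ^+ i]exprNn.
  have -> : 'X^((j + i) * (j + i - 1)) =
     'X^(j * (j - 1)) * qX2 ^+ 'C(i, 2) * qX2 ^+ j ^+ i :> {poly int}.
    rewrite -!exprM -!exprD; congr ('X^ _).
    by have := mul_pred_bin2 i; case: (i : nat) (j) => [|?] [|?]; nia.
  have -> : (-1) ^+ (j + l - i) = (-1) ^+ (j + l) * (-1) ^+ i :> {poly int}.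
    by rewrite -signr_odd oddB ?signr_addb ?signr_odd //; lia.
  ring.
suff dA : pdvd (qneg n) (gbin qX2 n j.*2 * qneg j.*2 * qpoch (qX2 ^+ j) qX2 l).
  have -> : A j * (-1) ^+ (j + l) * 'X^(j * (j - 1)) * qpoch (qX2 ^+ j) qX2 l
   = 'X^('C(j.*2, 2)) * (-1) ^+ (j + l) * 'X^(j * (j - 1)) *
      (gbin qX2 n j.*2 * qneg j.*2 * qpoch (qX2 ^+ j) qX2 l).
    by rewrite /A; ring.
  exact: pdvd_mull.
(* For [j = 0] the product is (1;q^2)_n, which is 0 because [n > 0]. *)
have [j0 | j_gt0] := posnP j.
  by rewrite /l j0 subn0 -(prednK n_gt0) qpoch1 mulr0; exists 0; rewrite mulr0.
have [u ->] := pdvd_qneg_qpoch l j_gt0.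
exists (qbin n j.*2 * u).
have := gbin_qneg j.*2 l; rewrite -nE => E.
ring: E.
Qed.

(** * Transfer between power series over Q(q) and [qconv] *)

Local Notation Kq := {fraction {poly int}}.
Local Notation "p %:F" := (@tofrac {poly int} p).
Local Notation q := ('X%:F : Kq).

(* The variable of this power series stands for x^2. *)
Definition qgf (u : nat -> {poly int}) : nat -> Kq :=
  fun n => (u n)%:F / qpoch q q n.*2.

Lemma qgf_inj u v : qgf u =1 qgf v -> u =1 v.
Proof.
move=> uv n; apply/eqP; rewrite -tofrac_eq; apply/eqP.
by have := uv n; apply: mulIf; rewrite invr_eq0 qpoch_neq0.
Qed.

Lemma fps_mul_qgf u v : fps_mul (qgf u) (qgf v) =1 qgf (qconv u v).
Proof.
move=> n; rewrite /qgf /qconv rmorph_sum mulr_suml.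
apply: eq_bigr => k _; have le_kn : (k <= n)%N by rewrite -ltnS.
rewrite !rmorphM /=.
have := congr1 (@tofrac _) (qbin_fact (n - k).*2 k.*2).
rewrite -doubleD subnKC // !rmorphM /= -!tofrac_qpoch => E.
apply: (mulIf (qpoch_neq0 n.*2)); rewrite divfK ?qpoch_neq0 // -E.
rewrite mulf_div -[_ * _ * qpoch q q _]mulrA mulrCA.
by rewrite divfK ?mulf_neq0 ?qpoch_neq0 // mulrA.
Qed.

Lemma eq_fps_mul (K : fieldType) (f f' g g' : nat -> K) :
  f =1 f' -> g =1 g' -> fps_mul f g =1 fps_mul f' g'.
Proof. by move=> ff' gg' n; apply: eq_bigr => k _; rewrite ff' gg'. Qed.

Lemma qconvA u v w : qconv (qconv u v) w =1 qconv u (qconv v w).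
Proof.
apply: qgf_inj => n; rewrite -!fps_mul_qgf.
rewrite -(eq_fps_mul (@fps_mul_qgf u v) (frefl _)) fps_mulA.
exact/eq_fps_mul/fps_mul_qgf.
Qed.

Lemma sum_even (V : nmodType) (F : nat -> V) n :
  (forall i, (i < n)%N -> F i.*2.+1 = 0) ->
  \sum_(i < n.*2.+1) F i = \sum_(k < n.+1) F k.*2.
Proof.
elim: n => [|n IHn] F0; first by rewrite !big_ord1.
rewrite doubleS 2!big_ord_recr [RHS]big_ord_recr /= F0 // addr0.
by rewrite IHn // => i lt_in; apply: F0; apply: ltnW.
Qed.

Lemma fps_mul_even (K : fieldType) (f h : nat -> K) n :
  fps_mul f (fps_even h) n.*2 = fps_mul (fun k => f k.*2) h n.
Proof.
rewrite /fps_mul (sum_even (F := fun i => f i * fps_even h (n.*2 - i)%N)).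
  by apply: eq_bigr => k _; rewrite -doubleB /fps_even odd_double doubleK.
move=> i lt_in; rewrite /fps_even ifT ?mulr0 //.
by rewrite oddB ?oddS ?odd_double //; lia.
Qed.

(** The defining identity of the q-Salie numbers, cleared of its denominator and read at even
    exponents. *)
Lemma qconv_qSalie :
  qconv (fun k => qSalie k.*2) (fun k => (-1) ^+ k * 'X^('C(k.*2, 2)))
  =1 (fun k => 'X^(k * (k - 1))).
Proof.
apply: qgf_inj => n; rewrite -fps_mul_qgf.
have den0 : qSalie_den 0%N != 0.
  by rewrite /qSalie_den /fps_even /= qpoch0 !mul1r invr1 oner_eq0.
have := @fps_divK _ qSalie_num qSalie_den den0 n.*2.
rewrite [qSalie_num n.*2]/qSalie_num /fps_even odd_double half_double.
rewrite /qgf rmorphXn => <-.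
rewrite fps_mul_even; apply: eq_fps_mul => k.
  by rewrite qSalieE /qSalie_frac mulrC mulKf ?qpoch_neq0.
by rewrite rmorphM !rmorphXn rmorphN1.
Qed.

(* cos_q(x) Cos_q(x) = (1 + sum_n (-1)^n (-1;q)_{2n} x^(2n) / (q;q)_{2n}) / 2,
   where Cos_q is the denominator and cos_q = sum_n (-1)^n x^(2n) / (q;q)_{2n}. *)
Lemma qconv_qcos :
  qconv (fun k => (-1) ^+ k * 'X^('C(k.*2, 2))) (fun k => (-1) ^+ k)
  =1 (fun n => if n is 0 then 1 else (-1) ^+ n * qneg n.*2.-1).
Proof.
case=> [|n]; first by rewrite /qconv big_ord1 /= !mulr1.
set N := n.+1; apply: (@mulfI _ 2); first by rewrite -polyC_natr polyC_eq0.
(* The q-binomial theorem at z = 1 and z = -1: adding the two doubles the even terms and cancels the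
   odd ones. *)
have two : qpoch (- 1) 'X N.*2 + qpoch (- - 1) 'X N.*2 = 2 * qneg N.*2.-1.
  by rewrite opprK doubleS qpoch1 addr0 qpochSl mulN1r opprK.
rewrite mulrCA -two -!qbinomial_theorem -big_split /=.
pose F j := gbin 'X N.*2 j * ('X^('C(j, 2)) * (1 + (-1) ^+ j)) : {poly int}.
transitivity ((-1) ^+ N * \sum_(j < N.*2.+1) F j); last first.
  by congr (_ * _); apply: eq_bigr => j _; rewrite /F expr1n; ring.
rewrite sum_even => [|i _]; last first.
  by rewrite /F -signr_odd oddS odd_double expr1 subrr !mulr0.
rewrite /qconv !mulr_sumr; apply: eq_bigr => k _.
have le_kN : (k <= N)%N by rewrite -ltnS.
have -> : (-1) ^+ N = (-1) ^+ k * (-1) ^+ (N - k) :> {poly int}.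
  by rewrite -exprD subnKC.
by rewrite /F -(signr_odd _ k.*2) odd_double -qbinE; ring.
Qed.

(** * Strong induction on n *)

Lemma qbin_nn n : qbin n n = 1.
Proof. by elim: n => //= n ->; rewrite qbin_small // mulr0 addr0. Qed.

Theorem theorem1p2 (n : nat) :
  exists p : {poly int}, qSalie n.*2 = qpoch (- 'X) 'X n * p.
Proof.
change (pdvd (qneg n) (qSalie n.*2)).
elim/ltn_ind: n => n IHn.
pose s k := qSalie k.*2; pose c k : {poly int} := (-1) ^+ k.
pose b k : {poly int} := (-1) ^+ k * 'X^('C(k.*2, 2)).
have := pdvd_qneg_numerator n.
have -> : qconv (fun k => 'X^(k * (k - 1))) c n = qconv s (qconv b c) n.
  rewrite -qconvA; apply: eq_bigr => k _; congr (_ * _ * _).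
  exact/esym/qconv_qSalie.
(* The term [k = n] is [qSalie n.*2] itself; the others have smaller index. *)
rewrite {1}/qconv big_ord_recr /= subnn (qconv_qcos 0) qbin_nn mul1r mulr1.
set S := \sum_(k < n) _ => dS.
rewrite -[qSalie _](addKr S); apply: pdvd_add dS.
rewrite -[- S]mulN1r; apply/pdvd_mull/pdvd_sum => k _.
have [t] := IHn k (ltn_ord k); rewrite /s => ->.
have lt_kn := ltn_ord k; rewrite qconv_qcos.
(* Since n - k >= 1, n - k <= 2(n - k) - 1. With the factor (-q;q)_k from the induction hypothesis,
   [pdvd_qneg_conv] applies. *)
have [u] : pdvd (qneg (n - k)) (qneg (n - k).*2.-1).
  by apply: pdvd_qneg_le; lia.
case mE: (n - k)%N => [|m]; first by lia.
rewrite -mE => ->.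
have := pdvd_qneg_conv k (n - k); rewrite subnKC 1?ltnW // => dX.
have := pdvd_mull ((-1) ^+ (n - k) * t * u) dX.
by congr pdvd; ring.
Qed.
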